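(* Let $n\ge 2$ and let $M\in\mathrm{GL}(n,\mathbb{Z})$ have a characteristic polynomial $P(x)=\det(x\mathbf{1}-M)$ that is irreducible over $\mathbb{Z}$, and let $\lambda$ be a root of $P(x)$. Then the centralizer of $M$ in $\mathrm{GL}(n,\mathbb{Z})$ is isomorphic to a subgroup of finite index of the unit group $\mathcal{O}_{\max}^{\times}$ of the ring of integers $\mathcal{O}_{\max}$ of the algebraic number field $\mathbb{Q}(\lambda)$.
   Context: $\mathrm{GL}(n,\mathbb{Z})$ is the group of integer $n\times n$ matrices with determinant $\pm1$. The centralizer of $M$ is $\{G\in\mathrm{GL}(n,\mathbb{Z}): MG=GM\}$. *)

(* Defs.v *)
From HB Require Import structures.
From mathcomp Require Import all_boot all_order all_algebra all_field.
From mathcomp Require Import boolp.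

Set Implicit Arguments.
Unset Strict Implicit.
Unset Printing Implicit Defensive.

Import GRing.Theory.

(* The possibly infinite groups below are [groupType]s; the groups of fingroup
   and solvable are all finite. *)

(* [commute] is a proposition; equality on G is decidable. *)
Definition centralizer (G : groupType) (x : G) : {pred G} :=
  [pred g : G | (x * g == g * x)%g].

Section CentralizerGroup.
Variables (G : groupType) (x : G).

Fact centralizer_mul : mulg_closed (centralizer x).
Proof.
move=> g h; rewrite !inE => /eqP xg /eqP xh.
by apply/eqP; rewrite mulgA xg -!mulgA xh.
Qed.

Fact centralizer_one : (1%g : G) \in centralizer x.
Proof. by rewrite inE mulg1 mul1g. Qed.

Fact centralizer_inv : invg_closed (centralizer x).
Proof. by move=> g; rewrite !inE => /eqP xg; apply/eqP/commuteV. Qed.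

HB.instance Definition _ := isMulClosed.Build G (centralizer x) centralizer_mul.
HB.instance Definition _ :=
  isMul1Closed.Build G (centralizer x) centralizer_one.
HB.instance Definition _ := isInvClosed.Build G (centralizer x) centralizer_inv.
End CentralizerGroup.

Record subgroup (G : groupType) (S : groupClosed G) := Subgroup {
  subgroup_val :> G;
  _ : subgroup_val \in S
}.

Section SubgroupGroup.
Variables (G : groupType) (S : groupClosed G).

HB.instance Definition _ := [isSub for @subgroup_val G S].
HB.instance Definition _ := [Choice of subgroup S by <:].

Fact subgroup_closed : group_closed S.
Proof. by split; [exact: gpred1 | exact: gpredF]. Qed.

HB.instance Definition _ :=
  SubChoice_isSubGroup.Build G _ (subgroup S) subgroup_closed.
End SubgroupGroup.

(* Finitely many left cosets r * S, with r in rs, cover G. *)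
Definition finite_index (G : groupType) (S : groupClosed G) : Prop :=
  exists rs : seq G, forall x : G, exists2 r, r \in rs & (r^-1 * x)%g \in S.

Definition group_isomorphic (G H : groupType) : Prop :=
  exists f : {multiplicative G -> H}, bijective f.

Local Open Scope ring_scope.

Record unit_group (R : unitRingType) := UnitGroup {
  unit_group_val :> R;
  _ : unit_group_val \is a GRing.unit
}.

Section UnitGroup.
Variable R : unitRingType.

HB.instance Definition _ := [isSub for @unit_group_val R].
HB.instance Definition _ := [Choice of unit_group R by <:].

Implicit Types x y z : unit_group R.

Definition unit_group_one : unit_group R := UnitGroup (unitr1 R).

Fact unit_group_inv_subproof x : (val x)^-1 \is a GRing.unit.
Proof. by rewrite unitrV; exact: valP x. Qed.

Definition unit_group_inv x : unit_group R :=
  UnitGroup (unit_group_inv_subproof x).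

Fact unit_group_mul_subproof x y : val x * val y \is a GRing.unit.
Proof. by rewrite unitrMl; [exact: valP x | exact: valP y]. Qed.

Definition unit_group_mul x y : unit_group R :=
  UnitGroup (unit_group_mul_subproof x y).

Fact unit_group_mulA : associative unit_group_mul.
Proof. by move=> x y z; apply: val_inj; exact: mulrA. Qed.

Fact unit_group_1mul : left_id unit_group_one unit_group_mul.
Proof. by move=> x; apply: val_inj; exact: mul1r. Qed.

Fact unit_group_mul1 : right_id unit_group_one unit_group_mul.
Proof. by move=> x; apply: val_inj; exact: mulr1. Qed.

Fact unit_group_Vmul :
  left_inverse unit_group_one unit_group_inv unit_group_mul.
Proof. by move=> x; apply: val_inj; exact: mulVr (valP x). Qed.

Fact unit_group_mulV :
  right_inverse unit_group_one unit_group_inv unit_group_mul.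
Proof. by move=> x; apply: val_inj; exact: mulrV (valP x). Qed.

HB.instance Definition _ := isGroup.Build (unit_group R)
  unit_group_mulA unit_group_1mul unit_group_mul1
  unit_group_Vmul unit_group_mulV.
End UnitGroup.

(* [unitmx] says that the determinant is a unit of int, i.e. 1 or -1.  The
   type [unit_group 'M[int]_n] would only make sense for n a successor, and
   {'GL_n[R]} requires R finite. *)
Record GLZ (n : nat) := MkGLZ {
  GLZ_val :> 'M[int]_n;
  _ : GLZ_val \in unitmx
}.

Section GLZGroup.
Variable n : nat.

HB.instance Definition _ := [isSub for @GLZ_val n].
HB.instance Definition _ := [Choice of GLZ n by <:].

Implicit Types A B C : GLZ n.

Definition GLZ_one : GLZ n := MkGLZ (unitmx1 _ n).

Fact GLZ_inv_subproof A : invmx (val A) \in unitmx.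
Proof. by rewrite unitmx_inv; exact: valP A. Qed.

Definition GLZ_inv A : GLZ n := MkGLZ (GLZ_inv_subproof A).

Fact GLZ_mul_subproof A B : val A *m val B \in unitmx.
Proof.
by rewrite unitmx_mul; apply/andP; split; [exact: valP A | exact: valP B].
Qed.

Definition GLZ_mul A B : GLZ n := MkGLZ (GLZ_mul_subproof A B).

Fact GLZ_mulA : associative GLZ_mul.
Proof. by move=> A B C; apply: val_inj; exact: mulmxA. Qed.

Fact GLZ_1mul : left_id GLZ_one GLZ_mul.
Proof. by move=> A; apply: val_inj; exact: mul1mx. Qed.

Fact GLZ_mul1 : right_id GLZ_one GLZ_mul.
Proof. by move=> A; apply: val_inj; exact: mulmx1. Qed.

Fact GLZ_Vmul : left_inverse GLZ_one GLZ_inv GLZ_mul.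
Proof. by move=> A; apply: val_inj; exact: mulVmx (valP A). Qed.

Fact GLZ_mulV : right_inverse GLZ_one GLZ_inv GLZ_mul.
Proof. by move=> A; apply: val_inj; exact: mulmxV (valP A). Qed.

HB.instance Definition _ := isGroup.Build (GLZ n)
  GLZ_mulA GLZ_1mul GLZ_mul1 GLZ_Vmul GLZ_mulV.
End GLZGroup.

(* For R = {poly int} this is irreducibility over Z.  The library's
   [irreducible_poly] is based on pseudo-division, so on {poly int} it is
   irreducibility over the fraction field. *)
Definition irreducible (R : idomainType) (p : R) : Prop :=
  [/\ p != 0, p \isn't a GRing.unit &
      forall q r : R, p = q * r ->
        q \is a GRing.unit \/ r \is a GRing.unit].

Definition algebraic_integer (K : fieldExtType rat) : {pred K} :=
  fun x => `[< integralOver (intr : int -> K) x >].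

Arguments algebraic_integer : clear implicits.

Record ring_of_integers (K : fieldExtType rat) := RingOfIntegers {
  ring_of_integers_val :> K;
  _ : ring_of_integers_val \in algebraic_integer K
}.

Section RingOfIntegers.
Variable K : fieldExtType rat.

HB.instance Definition _ := [isSub for @ring_of_integers_val K].
HB.instance Definition _ := [Choice of ring_of_integers K by <:].

Fact algebraic_integer_subring : subring_closed (algebraic_integer K).
Proof.
split=> [|x y /asboolP xI /asboolP yI|x y /asboolP xI /asboolP yI].
- by apply/asboolP; exact: integral1.
- by apply/asboolP; exact: integral_sub.
- by apply/asboolP; exact: integral_mul.
Qed.

HB.instance Definition _ := GRing.SubChoice_isSubComNzRing.Build
  K _ (ring_of_integers K) algebraic_integer_subring.

Implicit Types x y : ring_of_integers K.

Definition ring_of_integers_unit : {pred ring_of_integers K} :=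
  fun x => (val x != 0) && ((val x)^-1 \in algebraic_integer K).

Definition ring_of_integers_inv x : ring_of_integers K := insubd x (val x)^-1.

Fact ring_of_integers_mulV :
  {in ring_of_integers_unit, left_inverse 1 ring_of_integers_inv *%R}.
Proof.
move=> x /andP[x0 xVI]; apply: val_inj.
by rewrite GRing.valM insubdK // GRing.val1 mulVf.
Qed.

Fact ring_of_integers_unitP x y : y * x = 1 -> ring_of_integers_unit x.
Proof.
move=> /(congr1 val); rewrite GRing.valM GRing.val1 => yx1.
have x0 : val x != 0.
  by apply: contra_eq_neq yx1 => ->; rewrite mulr0 eq_sym oner_neq0.
rewrite /ring_of_integers_unit x0 /=.
by have -> : (val x)^-1 = val y; [rewrite -[LHS]mul1r -yx1 mulfK | exact: valP].
Qed.

Fact ring_of_integers_inv_out :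
  {in [predC ring_of_integers_unit], ring_of_integers_inv =1 id}.
Proof.
move=> x; rewrite inE /= negb_and negbK => /orP[/eqP x0|xVI].
  have xV : (val x)^-1 = val x by rewrite x0 invr0.
  by apply: val_inj; rewrite val_insubd xV; case: ifP.
by rewrite /ring_of_integers_inv /insubd insubN.
Qed.

HB.instance Definition _ := GRing.ComNzRing_hasMulInverse.Build
  (ring_of_integers K)
  ring_of_integers_mulV ring_of_integers_unitP ring_of_integers_inv_out.
End RingOfIntegers.

(* Main.v *)
Require Import Defs.
From HB Require Import structures.
From mathcomp Require Import all_boot all_order all_algebra all_field.
From mathcomp Require Import boolp.

Set Implicit Arguments.
Unset Strict Implicit.
Unset Printing Implicit Defensive.

Import GRing.Theory.
Local Open Scope ring_scope.

(* Let [w] be an eigenvector of [M] for [lambda] with entries in Q(lambda) = [K],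
   scaled so that they lie in the ring of integers [O].  Irreducibility makes the
   entries of [w] a Q-basis of [K].  An integer matrix [G] commuting with [M]
   maps [w] into the same eigenline, [G w = a w], and [G |-> a] identifies the
   centralizer with the units of [O] that stabilize the lattice spanned by the
   entries of [w].  The trace form gives an integer [D != 0] such that [D * O]
   lies in this lattice; as the lattice lies in [O], multiplication by [D * O]
   preserves it.  Hence every unit congruent to 1 modulo [D * O] stabilizes the
   lattice, and there are finitely many residue classes modulo [D * O]. *)

(** * Preliminaries on groups, polynomials and traces *)

Lemma group_isomorphic_morph (G H : groupType) (f : G -> H) :
  {morph f : x y / (x * y)%g} -> bijective f -> group_isomorphic G H.
Proof.
move=> fM f_bij; pose fm := isMultiplicative.Build G H f fM.
by exists (HB.pack f fm : {multiplicative G -> H}).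
Qed.

Lemma finite_fiber_representatives (T : eqType) (F : finType) (f : T -> F) :
  exists rs : seq T, forall x, exists2 r, r \in rs & f r = f x.
Proof.
have /choice[g gP] : forall a : F, exists o : option T,
    if o is Some r then f r = a else forall x, f x <> a.
  move=> a; have [[r fr]|nofr] := pselect (exists r, f r = a).
    by exists (Some r).
  by exists None => x fx; apply: nofr; exists x.
exists (pmap g (enum F)) => x; move: (gP (f x)).
case gx: (g (f x)) => [r|] fr; last by case: (fr x).
by exists r; rewrite // mem_pmap -gx map_f // mem_enum.
Qed.

(** By Gauss's lemma the rational gcd is a scalar multiple of an integer factor of [P]. If the
    cofactor is a unit, the gcd has the size of [P], too large to divide [q]; so the factor itself
    is a unit. *)
Lemma irreducible_rat_coprime (P : {poly int}) (q : {poly rat}) :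
  irreducible P -> q != 0 -> (size q < size P)%N ->
  coprimep (map_poly intr P) q.
Proof.
move=> [P0 _ Pirr] q0 qP; set PQ := map_poly _ P.
rewrite /coprimep; set g := gcdp PQ q.
have g_le : (size g <= size q)%N by rewrite dvdp_leq ?dvdp_gcdr.
have gPQ : g %| PQ by exact: dvdp_gcdl.
have [p1 [a a0 ga] [r Pr]] := dvdpP_rat_int gPQ.
have sg : size g = size p1.
  by rewrite ga size_scale // size_map_inj_poly //; exact: intr_inj.
have [p1U|rU] := Pirr _ _ Pr; rewrite sg.
  by move: p1U; rewrite poly_unitE => /andP[].
have sr : size r == 1%N by move: rU; rewrite poly_unitE => /andP[].
move: P0 qP g_le; rewrite Pr mulf_eq0 negb_or => /andP[p10 r0].
by rewrite size_mul // (eqP sr) addn1 /= ltnNge sg => /negPf->.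
Qed.

Lemma horner_mx_eigen (R : comNzRingType) n (A : 'M[R]_n.+1) (w : 'cV[R]_n.+1) a
    (p : {poly R}) :
  A *m w = a *: w -> horner_mx A p *m w = p.[a] *: w.
Proof.
move=> Aw; elim/poly_ind: p => [|p c IHp].
  by rewrite rmorph0 horner0 mul0mx scale0r.
rewrite rmorphD rmorphM /= horner_mx_X horner_mx_C hornerMXaddC mulmxDl.
rewrite -mulmxA Aw -scalemxAr IHp scalerA mul_scalar_mx scalerDl.
by rewrite [a * _]mulrC.
Qed.

(** The trace is the sum of the complex eigenvalues. Each is a root of the minimal polynomial, hence
    of [p], hence an algebraic integer; a rational algebraic integer is an integer. *)
Lemma trace_int n (A : 'M[rat]_n.+1) (p : {poly int}) :
  p \is monic -> horner_mx A (map_poly intr p) = 0 ->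
  exists z : int, \tr A = z%:~R.
Proof.
move=> p_monic pA0; pose B := map_mx (ratr : rat -> algC) A.
have [r] := closed_field_poly_normal (char_poly B).
rewrite (monicP (char_poly_monic B)) scale1r => Br.
have size_r : size r = n.+1.
  by apply: succn_inj; rewrite -(size_char_poly B) Br size_prod_XsubC.
have trB : \tr B = \sum_(z <- r) z.
  apply: oppr_inj; rewrite -char_poly_trace // Br -size_r.
  by rewrite coefPn_prod_XsubC // size_r.
have Bp : horner_mx B (map_poly intr p) = 0.
  have -> : map_poly (intr : int -> algC) p = map_poly ratr (map_poly intr p).
    by rewrite -map_poly_comp; apply: eq_map_poly => z /=; rewrite ratr_int.
  by rewrite -map_horner_mx pA0 map_mx0.
have trI : \tr B \in Aint.
  rewrite trB big_seq rpred_sum // => z zr.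
  have rz : root (char_poly B) z by rewrite Br root_prod_XsubC.
  have: root (map_poly (intr : int -> algC) p) z.
    rewrite -dvdp_XsubCl; apply: dvdp_trans (mxminpoly_min Bp).
    by rewrite dvdp_XsubCl -eigenvalue_root_min eigenvalue_root_char.
  move/root_monic_Aint; apply; first exact: monic_map.
  by apply/polyOverP => i; rewrite coef_map /= rpred_int.
have trQ : \tr B = ratr (\tr A) by exact: trace_map_mx.
have /Num.Theory.intrP[z zE] : \tr B \is a Num.int.
  by apply: Cint_rat_Aint => //; rewrite trQ; exact: Crat_rat.
exists z; apply: (fmorph_inj (ratr : {rmorphism rat -> algC})).
by rewrite /= -trQ zE ratr_int.
Qed.

HB.instance Definition _ (K : fieldExtType rat) := GRing.isSubringClosed.Build
  K (algebraic_integer K) (algebraic_integer_subring K).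

(** * Bases of the field and the trace form *)

Section LatticeBasis.
Variables (K : fieldExtType rat) (n : nat) (w : 'cV[K]_n.+1).

Definition rat_free :=
  forall c : 'rV[rat]_n.+1, map_mx (in_alg K) c *m w = 0 -> c = 0.

Definition rat_spanning :=
  forall y : K, exists c : 'rV[rat]_n.+1, map_mx (in_alg K) c *m w = y%:M.

Lemma map_mx_in_alg_intr m p (A : 'M[int]_(m, p)) :
  map_mx (in_alg K) (map_mx intr A) = map_mx intr A.
Proof. by apply/matrixP => i j; rewrite !mxE rmorph_int. Qed.

Hypotheses (w_free : rat_free) (w_span : rat_spanning).

Lemma rat_free_inj m (A B : 'M[rat]_(m, n.+1)) :
  map_mx (in_alg K) A *m w = map_mx (in_alg K) B *m w -> A = B.
Proof.
move=> AB; apply/subr0_eq/row_matrixP => i; rewrite row0; apply: w_free.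
by rewrite map_row -row_mul map_mxB mulmxBl AB subrr row0.
Qed.

Lemma int_free_inj m (A B : 'M[int]_(m, n.+1)) :
  map_mx intr A *m w = map_mx intr B *m w -> A = B.
Proof.
rewrite -!map_mx_in_alg_intr => /rat_free_inj/matrixP AB.
by apply/matrixP => i j; have := AB i j; rewrite !mxE => /intr_inj.
Qed.

(** Row [i] of [rho y] holds the coordinates of [y * w i 0], so the trace of [rho y] is the field
    trace of [y] over the rationals. *)
Lemma regular_representation :
  exists rho : K -> 'M[rat]_n.+1,
    forall y, map_mx (in_alg K) (rho y) *m w = y *: w.
Proof.
have /choice[coord coordP] := w_span.
exists (fun y => \matrix_i coord (y * w i 0)) => y.
apply/row_matrixP => i; rewrite row_mul -map_row rowK coordP.
by apply/matrixP => j k; rewrite !mxE !ord1 eqxx.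
Qed.

(** If a monic [p] kills [x], then [p] evaluated at [A] kills [w], so it vanishes by freeness and
    [trace_int] applies. *)
Lemma trace_integral x (A : 'M[rat]_n.+1) :
  x \in algebraic_integer K -> map_mx (in_alg K) A *m w = x *: w ->
  exists z : int, \tr A = z%:~R.
Proof.
move=> /asboolP[p p_monic px0] Ax; apply: (trace_int p_monic).
apply: rat_free_inj; rewrite map_mx0 mul0mx map_horner_mx.
rewrite (horner_mx_eigen _ Ax) -map_poly_comp.
rewrite (eq_map_poly (g := intr)); last exact: (rmorph_int (in_alg K)).
by rewrite (rootP px0) scale0r.
Qed.

Hypothesis w_integral : forall i, w i 0 \in algebraic_integer K.

(* The Gram matrix [T] of the trace form in the basis [w] is integral, and
   [\det T] is the denominator; it is nonzero because a vector [c] in the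
   kernel gives [y = c w] with [0 = tr (y * y^-1) = n.+1]. *)
Lemma integral_denominator :
  exists2 D : int, D != 0 & forall x, x \in algebraic_integer K ->
    exists c : 'rV[int]_n.+1, map_mx intr c *m w = (D%:~R * x)%:M.
Proof.
have [rho rhoP] := regular_representation.
have rho_lin m (a : 'I_m -> rat) (y : 'I_m -> K) :
    rho (\sum_i in_alg K (a i) * y i) = \sum_i a i *: rho (y i).
  apply: rat_free_inj; rewrite rhoP scaler_suml map_mx_sum mulmx_suml.
  apply: eq_bigr => i _.
  by rewrite map_mxZ -scalemxAl rhoP scalerA.
have rho1 : rho 1 = 1%:M.
  by apply: rat_free_inj; rewrite rhoP map_mx1 mul1mx scale1r.
(* The implication sits under the existential so that choice yields a total function [t]; its value
   off the algebraic integers is arbitrary. *)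
have trP x : exists z : int, x \in algebraic_integer K -> \tr (rho x) = z%:~R.
  have [/trace_integral/(_ (rhoP x))[z xz]|xI] := boolP (x \in _).
    by exists z.
  by exists 0.
have /choice[t tP] := trP.
pose T := \matrix_(i, j) t (w i 0 * w j 0).
have TE (c : 'rV[rat]_n.+1) x : map_mx (in_alg K) c *m w = x%:M ->
    c *m map_mx intr T = \row_j \tr (rho (x * w j 0)).
  move=> cx; have xE : x = \sum_i in_alg K (c 0 i) * w i 0.
    have := congr1 (fun A : 'M_1 => A 0 0) cx; rewrite !mxE eqxx mulr1n => <-.
    by apply: eq_bigr => i _; rewrite mxE.
  apply/rowP => j; rewrite !mxE xE mulr_suml.
  under [in RHS]eq_bigr => i _ do rewrite -mulrA.
  rewrite rho_lin raddf_sum; apply: eq_bigr => i _.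
  by rewrite /= mxtraceZ tP ?mxE //; apply: rpredM; exact: w_integral.
have detT : \det T != 0.
  apply/eqP => detT0.
  have /det0P[c c0 cT] : \det (map_mx intr T : 'M[rat]_n.+1) == 0.
    by rewrite det_map_mx detT0.
  pose y := (map_mx (in_alg K) c *m w) 0 0.
  have cy : map_mx (in_alg K) c *m w = y%:M by exact: mx11_scalar.
  have y0 : y != 0.
    by apply: contraNneq c0 => y0; apply/eqP/w_free; rewrite cy y0 raddf0.
  have [e ye] := w_span y^-1.
  have yVE : y^-1 = \sum_j in_alg K (e 0 j) * w j 0.
    have := congr1 (fun A : 'M_1 => A 0 0) ye; rewrite !mxE eqxx mulr1n => <-.
    by apply: eq_bigr => j _; rewrite mxE.
  have : \tr (rho (y * y^-1)) = 0.
    rewrite yVE mulr_sumr.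
    under eq_bigr => j _ do rewrite mulrCA.
    rewrite rho_lin raddf_sum big1 // => j _ /=.
    have := congr1 (fun A : 'rV_n.+1 => A 0 j) (TE _ _ cy).
    by rewrite cT !mxE mxtraceZ => <-; rewrite mulr0.
  by rewrite mulfV // rho1 mxtrace1 => /eqP; rewrite Num.Theory.pnatr_eq0.
exists (\det T) => // x xI; have [c cx] := w_span x.
pose u : 'rV[int]_n.+1 := \row_j t (x * w j 0).
have cT : c *m map_mx intr T = map_mx intr u.
  rewrite (TE _ _ cx); apply/rowP => j; rewrite !mxE tP //.
  by apply: rpredM; last exact: w_integral.
(* Cramer's rule: [u] is [c] times the Gram matrix, so multiplying by the adjugate gives [\det T]
   times [c]. *)
exists (u *m \adj T).
rewrite -map_mx_in_alg_intr map_mxM -cT -mulmxA -map_mxM mul_mx_adj.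
rewrite map_scalar_mx mul_mx_scalar map_mxZ -scalemxAl cx rmorph_int.
by rewrite scale_scalar_mx.
Qed.

End LatticeBasis.

(** * Eigenvectors of integer matrices *)

Lemma char_poly_trmx (R : comNzRingType) n (A : 'M[R]_n) :
  char_poly A^T = char_poly A.
Proof.
rewrite /char_poly -[RHS]det_tr /char_poly_mx raddfB /= tr_scalar_mx.
by rewrite map_trmx.
Qed.

Lemma algebraic_integer_int (K : fieldExtType rat) (z : int) :
  z%:~R \in algebraic_integer K.
Proof. exact: rpred_int. Qed.

Lemma eigenvalue_algebraic_integer (K : fieldExtType rat) n (A : 'M[int]_n.+1)
    (w : 'cV[K]_n.+1) (a : K) :
  w != 0 -> map_mx intr A *m w = a *: w -> a \in algebraic_integer K.
Proof.
move=> w0 Aw; apply/asboolP; exists (char_poly A); first exact: char_poly_monic.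
have := horner_mx_eigen (char_poly (map_mx intr A)) Aw.
rewrite Cayley_Hamilton mul0mx map_char_poly => /esym/eqP.
by rewrite scaler_eq0 (negPf w0) orbF.
Qed.

Section Eigenvector.
Variables (K : fieldExtType rat) (n : nat) (M : 'M[int]_n.+1) (theta : K).
Hypothesis M_irr : irreducible (char_poly M).

(** A relation [c] on [w] makes every [c *m MQ ^+ i] a relation, so the matrix [C] of these rows
    kills [w]. For nonzero [c] it is invertible: a kernel vector is a nonzero polynomial of degree
    below that of the characteristic polynomial, and Bezout with Cayley-Hamilton would give
    [c = 0]. *)
Lemma eigenvector_rat_free (w : 'cV[K]_n.+1) :
  w != 0 -> map_mx intr M *m w = theta *: w -> rat_free w.
Proof.
move=> w0 Mw c cw0; apply/eqP; apply: contraNT w0 => c0.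
pose MQ : 'M[rat]_n.+1 := map_mx intr M.
pose C := \matrix_(i < n.+1) (c *m MQ ^+ i).
have Cw : map_mx (in_alg K) C *m w = 0.
  apply/row_matrixP => i; rewrite row_mul -map_row rowK row0 map_mxM -mulmxA.
  have Mi : map_mx (in_alg K) (MQ ^+ i) *m w = theta ^+ i *: w.
    rewrite (_ : MQ ^+ i = horner_mx MQ 'X^i); last first.
      by rewrite rmorphXn /= horner_mx_X.
    rewrite map_horner_mx map_mx_in_alg_intr map_polyXn (horner_mx_eigen _ Mw).
    by rewrite hornerXn.
  by rewrite Mi -scalemxAr cw0 scaler0.
suff CU : map_mx (in_alg K) C \in unitmx.
  by rewrite -[w](mulKmx CU) Cw mulmx0.
rewrite map_unitmx unitmxE unitfE; apply/det0P => -[r r0 rC].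
have q0 : rVpoly r != 0.
  by apply: contraNneq r0 => q0; rewrite -[r]rVpolyK q0 linear0.
have rq : r *m C = c *m horner_mx MQ (rVpoly r).
  rewrite mulmx_sum_row [rVpoly r]poly_def raddf_sum mulmx_sumr.
  apply: eq_bigr => i _; rewrite rowK valK /= linearZ /= rmorphXn /=.
  by rewrite horner_mx_X scalemxAr.
have /Bezout_eq1_coprimepP[[u v] /= uv] :
    coprimep (map_poly intr (char_poly M)) (rVpoly r).
  apply: irreducible_rat_coprime => //.
  by rewrite size_char_poly ltnS size_poly.
have := congr1 (fun p => c *m horner_mx MQ p) uv.
rewrite [v * _]mulrC rmorphD !rmorphM /= map_char_poly Cayley_Hamilton.
rewrite mulr0 add0r mulmxA -rq rC mul0mx rmorph1 mulmx1 => /esym/eqP.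
by rewrite (negPf c0).
Qed.

Hypothesis theta_gen : forall y : K,
  exists p : {poly rat}, y = (map_poly (in_alg K) p).[theta].

(** With [w k 0] nonzero and [y / w k 0] equal to [p] at [theta], row [k] of [p] at [M] sends [w] to
    [y]. *)
Lemma eigenvector_rat_spanning (w : 'cV[K]_n.+1) :
  w != 0 -> map_mx intr M *m w = theta *: w -> rat_spanning w.
Proof.
move=> /matrix0Pn[k [j]]; rewrite ord1 => wk0 Mw y.
have [p py] := theta_gen (y / w k 0).
exists (row k (horner_mx (map_mx intr M) p)).
rewrite map_row map_horner_mx map_mx_in_alg_intr -row_mul.
rewrite (horner_mx_eigen _ Mw) -py; apply/matrixP => i l.
by rewrite !mxE !ord1 eqxx divfK.
Qed.

Hypothesis theta_root : root (map_poly intr (char_poly M)) theta.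

Lemma denominator_algebraic_integer (y : K) :
  exists2 m : int, m != 0 & m%:~R * y \in algebraic_integer K.
Proof.
have [p ->] := theta_gen y; have [q [a a0 ->]] := rat_poly_scale p.
exists a => //; rewrite map_polyZ hornerZ mulrA fmorphV rmorph_int mulfV.
  rewrite mul1r; apply: rpred_horner.
    apply/polyOverP => i; rewrite !coef_map /= -/(in_alg K _) rmorph_int.
    exact: algebraic_integer_int.
  by apply/asboolP; exists (char_poly M); first exact: char_poly_monic.
by rewrite -(rmorph_int (in_alg K)) fmorph_eq0 intr_eq0.
Qed.

Lemma integral_eigenvector : exists w : 'cV[K]_n.+1,
  [/\ w != 0, map_mx intr M *m w = theta *: w &
      forall i, w i 0 \in algebraic_integer K].
Proof.
(* [eigenvalue] concerns row vectors, so a column eigenvector of [M] is found through the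
   transpose. *)
have /eigenvalueP[v vM v0] : eigenvalue (map_mx intr M)^T theta.
  by rewrite eigenvalue_root_char char_poly_trmx -map_char_poly.
have /choice[m mP] : forall i, exists m : int,
    m != 0 /\ m%:~R * v 0 i \in algebraic_integer K.
  by move=> i; have [m] := denominator_algebraic_integer (v 0 i); exists m.
pose m' : K := (\prod_i m i)%:~R.
have m'0 : m' != 0.
  rewrite /m' -(rmorph_int (in_alg K)) fmorph_eq0 intr_eq0.
  by apply/prodf_neq0 => i _; case: (mP i).
exists (m' *: v^T); split.
- by rewrite scaler_eq0 negb_or m'0 trmx_eq0.
- rewrite -scalemxAr -[map_mx _ _]trmxK -trmx_mul vM linearZ /=.
  by rewrite !scalerA mulrC.
- move=> i; rewrite !mxE /m' (bigD1 i) //= [m i * _]mulrC rmorphM -mulrA.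
  by apply: rpredM; [exact: algebraic_integer_int | case: (mP i)].
Qed.

End Eigenvector.

(** Lets the isomorphism be given as the relation between a matrix and its eigenvalue on [w], with
    no explicit function in either direction. *)
Lemma group_isomorphic_graph (G H : groupType) (R : G -> H -> Prop) :
  (forall x, exists y, R x y) -> (forall y, exists x, R x y) ->
  (forall x y y', R x y -> R x y' -> y = y') ->
  (forall x x' y, R x y -> R x' y -> x = x') ->
  (forall x x' y y', R x y -> R x' y' -> R (x * x')%g (y * y')%g) ->
  group_isomorphic G H.
Proof.
move=> /choice[f fP] /choice[g gP] Rfun Rinj RM.
apply: (@group_isomorphic_morph _ _ f) => [x y|].
  by apply: Rfun (fP _) _; exact: RM.
by exists g => x; [exact: Rinj (gP _) (fP _) | exact: Rfun (fP _) (gP _)].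
Qed.

(** * Units of the ring of integers and stabilizers of lattices *)

Section NumberFieldUnits.
Variable K : fieldExtType rat.
Local Notation units := (unit_group (ring_of_integers K)).

Definition unit_val (x : units) : K := val (val x).

Lemma unit_val_inj : injective unit_val.
Proof. by move=> x y /val_inj/val_inj. Qed.

Lemma unit_val_integral x : unit_val x \in algebraic_integer K.
Proof. exact: valP (val x). Qed.

Lemma unit_val1 : unit_val 1%g = 1.
Proof. exact: GRing.val1. Qed.

Lemma unit_valM : {morph unit_val : x y / (x * y)%g >-> x * y}.
Proof. by move=> x y; exact: GRing.valM. Qed.

Lemma unit_val_neq0 x : unit_val x != 0.
Proof.
apply/eqP => x0; have := unit_valM x^-1%g x.
by rewrite mulVg unit_val1 x0 mulr0 => /eqP; rewrite oner_eq0.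
Qed.

Lemma unit_valV : {morph unit_val : x / (x^-1)%g >-> x^-1}.
Proof.
move=> x; rewrite -[RHS]mul1r -unit_val1 -(mulVg x) unit_valM.
by rewrite mulfK // unit_val_neq0.
Qed.

Lemma unit_valP (a : K) :
  a != 0 -> a \in algebraic_integer K -> a^-1 \in algebraic_integer K ->
  exists x, unit_val x = a.
Proof.
move=> a0 aI aVI; pose b := RingOfIntegers aI.
have bU : b \is a GRing.unit by rewrite /in_mem /= /ring_of_integers_unit a0.
by exists (UnitGroup bU).
Qed.

(** [A] expresses multiplication by [x] on the generators [w] of the lattice; its invertibility over
    the integers says that [x] maps the lattice onto itself. *)
Definition lattice_stabilizer n (w : 'cV[K]_n) : {pred units} :=
  fun x => `[< exists2 A : 'M[int]_n,
    A \in unitmx & map_mx intr A *m w = unit_val x *: w >].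

Variables (n : nat) (w : 'cV[K]_n).

Fact lattice_stabilizer_mul : mulg_closed (lattice_stabilizer w).
Proof.
move=> x y /asboolP[A AU Ax] /asboolP[B BU Bx]; apply/asboolP.
exists (A *m B); first by rewrite unitmx_mul AU.
by rewrite map_mxM -mulmxA Bx -scalemxAr Ax scalerA unit_valM mulrC.
Qed.

Fact lattice_stabilizer_one : 1%g \in lattice_stabilizer w.
Proof.
apply/asboolP; exists 1%:M; first exact: unitmx1.
by rewrite map_mx1 mul1mx unit_val1 scale1r.
Qed.

Fact lattice_stabilizer_inv : invg_closed (lattice_stabilizer w).
Proof.
move=> x /asboolP[A AU Ax]; apply/asboolP.
exists (invmx A); first by rewrite unitmx_inv.
rewrite unit_valV -{1}[w](scalerK (unit_val_neq0 x)) -Ax -scalemxAr mulmxA.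
by rewrite -map_mxM mulVmx // map_mx1 mul1mx.
Qed.

HB.instance Definition _ :=
  isMulClosed.Build units (lattice_stabilizer w) lattice_stabilizer_mul.
HB.instance Definition _ :=
  isMul1Closed.Build units (lattice_stabilizer w) lattice_stabilizer_one.
HB.instance Definition _ :=
  isInvClosed.Build units (lattice_stabilizer w) lattice_stabilizer_inv.
End NumberFieldUnits.

(** * Finite index of the stabilizer *)

Section Lattice.
Variables (K : fieldExtType rat) (n : nat) (w : 'cV[K]_n.+1).
Hypotheses (w_free : rat_free w) (w_span : rat_spanning w).
Hypothesis w_integral : forall i, w i 0 \in algebraic_integer K.

(* Two units congruent modulo [D * O], hence in particular two units whose
   multiples by [D] have the same coordinates modulo [D ^ 2], differ by a
   stabilizer of the lattice, since [D * O] maps the lattice into itself. *)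
Lemma lattice_stabilizer_finite_index : finite_index (lattice_stabilizer w).
Proof.
have [D D0 DP] := integral_denominator w_free w_span w_integral.
have DK0 : D%:~R != 0 :> K.
  by rewrite -(rmorph_int (in_alg K)) fmorph_eq0 intr_eq0.
have D_stable a : a \in algebraic_integer K ->
    exists A : 'M[int]_n.+1, map_mx intr A *m w = (D%:~R * a) *: w.
  move=> aI; have /choice[c cP] : forall i, exists c : 'rV[int]_n.+1,
      map_mx intr c *m w = (D%:~R * (a * w i 0))%:M.
    by move=> i; apply: DP; apply: rpredM; [exact: aI | exact: w_integral].
  exists (\matrix_i c i); apply/row_matrixP => i.
  rewrite row_mul -map_row rowK cP; apply/matrixP => j k.
  by rewrite !mxE !ord1 eqxx mulrA.
have /choice[c cP] x := DP _ (unit_val_integral x).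
(* One factor [D] undoes the scaling in [cP]; the other survives as the [D] in [xr]. *)
pose N := D * D.
(* [inord] needs a successor as bound; residues modulo [N] stay below it, so none is truncated. *)
pose f x := [ffun i => inord `|(c x 0%R i %% N)%Z| : 'I_`|N|.+1].
have [rs rsP] := finite_fiber_representatives f.
exists rs => x; have [r r_rs fr] := rsP x; exists r => //.
have N0 : N != 0 by rewrite mulf_neq0.
have /choice[e eP] : forall i, exists e : int, c x 0 i - c r 0 i = e * N.
  move=> i; apply/dvdzP; rewrite -eqz_mod_dvd.
  have absK y : `|(y %% N)%Z|%:Z = (y %% N)%Z by rewrite gez0_abs ?modz_ge0.
  have lt_abs y : (`|(y %% N)%Z| < `|N|.+1)%N.
    by rewrite ltnS ltnW // -ltz_nat absK ltz_mod.
  have /(congr1 val) := (ffunP (f r) (f x)).2 fr i.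
  by rewrite !ffunE /= !inordK // -[X in X == _]absK -[X in _ == X]absK => ->.
pose z := (map_mx intr (\row_i e i) *m w) 0 0.
have zI : z \in algebraic_integer K.
  rewrite /z mxE; apply: rpred_sum => i _; rewrite !mxE.
  by apply: rpredM; [exact: algebraic_integer_int | exact: w_integral].
have xr : unit_val x = unit_val r + D%:~R * z.
  apply: (mulfI DK0); apply/eqP; rewrite mulrDr -subr_eq0 opprD addrA subr_eq0.
  apply/eqP; transitivity ((map_mx intr (c x - c r) *m w) 0 0).
    by rewrite map_mxB mulmxBl !cP !mxE eqxx !mulr1n.
  have -> : c x - c r = N *: \row_i e i.
    by apply/rowP => i; rewrite !mxE eP mulrC.
  by rewrite map_mxZ -scalemxAl mxE mulrA rmorphM.
(* The quotient [r^-1 * x] is [1 + D * r^-1 * z] and its inverse is [1 - D * x^-1 * z]; since both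
   act by integer matrices, [1%:M + A] is invertible over the integers. *)
have [A Ar] := D_stable _ (rpredM (unit_val_integral r^-1%g) zI).
have [B Bx] := D_stable _ (rpredM (unit_val_integral x^-1%g) zI).
have rx : map_mx intr (1%:M + A) *m w = unit_val (r^-1 * x)%g *: w.
  rewrite map_mxD map_mx1 mulmxDl mul1mx Ar -{1}[w]scale1r -scalerDl.
  rewrite unit_valM !unit_valV xr mulrDr mulVf ?unit_val_neq0 //.
  by rewrite mulrCA.
have xr' : map_mx intr (1%:M - B) *m w = unit_val (x^-1 * r)%g *: w.
  rewrite map_mxB map_mx1 mulmxBl mul1mx Bx -{1}[w]scale1r -scalerBl.
  rewrite unit_valM !unit_valV; congr (_ *: w).
  rewrite mulrCA -(addrK (D%:~R * z) (unit_val r)) -xr.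
  by rewrite mulrBr mulVf ?unit_val_neq0.
apply/asboolP; exists (1%:M + A) => //.
have AB1 : (1%:M + A) *m (1%:M - B) = 1%:M.
  apply: (int_free_inj w_free); rewrite map_mxM -mulmxA xr' -scalemxAr rx.
  rewrite scalerA map_mx1 mul1mx -unit_valM.
  by rewrite mulgA -(mulgA _ r) mulgV mulg1 mulVg unit_val1 scale1r.
by have [] := mulmx1_unit AB1.
Qed.

End Lattice.

(** * The centralizer as a lattice stabilizer *)

Lemma centralizer_isomorphic_stabilizer (K : fieldExtType rat) n (M : GLZ n.+1)
    (theta : K) (w : 'cV[K]_n.+1) :
  irreducible (char_poly (GLZ_val M)) ->
  w != 0 -> map_mx intr (GLZ_val M) *m w = theta *: w ->
  group_isomorphic (subgroup (centralizer M)) (subgroup (lattice_stabilizer w)).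
Proof.
move=> M_irr w0 Mw.
have w_free := eigenvector_rat_free M_irr w0 Mw.
have /matrix0Pn[k [j]] := w0; rewrite ord1 => wk0.
apply: (@group_isomorphic_graph _ _ (fun G x =>
  map_mx intr (GLZ_val (val G)) *m w = unit_val (val x) *: w)).
- move=> [G GC]; have := GC; rewrite inE => /eqP/(congr1 val)/= MG.
  pose MK := map_mx (intr : int -> K) (val M).
  pose GK := map_mx (intr : int -> K) (val G).
  pose a := (GK *m w) k 0 / w k 0.
  have Ga : GK *m w = a *: w.
    (* The difference, if nonzero, would be another eigenvector for [theta], so its entries would be
       free over the rationals; but its entry [k] is zero by the choice of [a]. *)
    apply/eqP; rewrite -subr_eq0; apply: contraT => d0.
    have dE : MK *m (GK *m w - a *: w) = theta *: (GK *m w - a *: w).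
      rewrite mulmxBr mulmxA -map_mxM MG map_mxM -mulmxA Mw -!scalemxAr Mw.
      by rewrite scalerBr !scalerA mulrC.
    suff /rowP/(_ k)/eqP : delta_mx 0 k = 0 :> 'rV[rat]_n.+1.
      by rewrite !mxE !eqxx oner_eq0.
    apply: (eigenvector_rat_free M_irr d0 dE); rewrite map_delta_mx -rowE.
    apply/matrixP => i l.
    have ak : a * w k 0 = (GK *m w) k 0 by rewrite divfK.
    by rewrite !mxE !ord1 ak mxE subrr.
  have a0 : a != 0.
    apply: contraNneq w0 => a0; have GU : GK \in unitmx.
      by rewrite unitmxE det_map_mx rmorph_unit // -unitmxE (valP G).
    by rewrite -[w](mulKmx GU) Ga a0 scale0r mulmx0.
  have aI := eigenvalue_algebraic_integer w0 Ga.
  have GaV : map_mx intr (invmx (val G)) *m w = a^-1 *: w.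
    rewrite -{1}[w](scalerK a0) -Ga -scalemxAr mulmxA.
    by rewrite -map_mxM mulVmx ?(valP G) // map_mx1 mul1mx.
  have [x xa] := unit_valP a0 aI (eigenvalue_algebraic_integer w0 GaV).
  have xS : x \in lattice_stabilizer w.
    by apply/asboolP; exists (val G); [exact: valP G | rewrite xa].
  by exists (Subgroup xS); rewrite /= xa.
- move=> [x xS]; have /asboolP[A AU Ax] := xS.
  (* Both products act on [w] as the same scalar, so freeness makes them equal. *)
  have AC : MkGLZ AU \in centralizer M.
    rewrite inE; apply/eqP/val_inj; apply: (int_free_inj w_free).
    by rewrite !map_mxM -!mulmxA /= Mw Ax -!scalemxAr Mw Ax !scalerA mulrC.
  by exists (Subgroup AC).
- move=> G x y -> /matrixP/(_ k 0); rewrite !mxE => /(mulIf wk0).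
  by move=> /unit_val_inj/val_inj.
- by move=> G H x <- /esym/(int_free_inj w_free)/val_inj/val_inj.
- move=> G H x y Gx Hy.
  by rewrite map_mxM -mulmxA Hy -scalemxAr Gx scalerA unit_valM mulrC.
Qed.

(** * Specialization to the field generated by the root *)

Lemma subvs_adjoin_gen (L : fieldExtType rat) (lambda : L)
    (y : subvs_of <<1; lambda>>%VS) :
  exists p : {poly rat},
    y = (map_poly (in_alg _) p).[Subvs (memv_adjoin 1 lambda)].
Proof.
have /Fadjoin_polyP[q /polyOver1P[p ->] yp] := subvsP y.
exists p; apply: val_inj; rewrite /= yp -horner_map /= -map_poly_comp.
congr (_.[_]); apply: eq_map_poly => c /=.
(* The one of the subfield shows up as [algid]; the embedding sends it to 1. *)
by rewrite -[algid _]/(vsval 1) rmorph1.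
Qed.

Lemma centralizer_finite_index (K : fieldExtType rat) n (M : GLZ n.+1)
    (theta : K) :
  irreducible (char_poly (GLZ_val M)) ->
  (forall y : K, exists p : {poly rat}, y = (map_poly (in_alg K) p).[theta]) ->
  root (map_poly intr (char_poly (GLZ_val M))) theta ->
  exists S : groupClosed (unit_group (ring_of_integers K)),
    finite_index S /\
    group_isomorphic (subgroup (centralizer M)) (subgroup S).
Proof.
move=> M_irr theta_gen theta_root.
have [w [w0 Mw w_int]] := integral_eigenvector theta_gen theta_root.
exists (lattice_stabilizer w : groupClosed _); split.
  apply: lattice_stabilizer_finite_index w_int.
    exact: (eigenvector_rat_free M_irr w0 Mw).
  exact: (eigenvector_rat_spanning theta_gen w0 Mw).
exact: centralizer_isomorphic_stabilizer M_irr w0 Mw.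
Qed.

Theorem lemma1 (n : nat) (n_ge2 : (2 <= n)%N) (M : GLZ n)
    (M_irr : irreducible (char_poly (GLZ_val M)))
    (L : fieldExtType rat) (lambda : L)
    (lambda_root :
       root (map_poly (intr : int -> L) (char_poly (GLZ_val M))) lambda) :
  exists S : groupClosed
      (unit_group (ring_of_integers (subvs_of <<1; lambda>>%VS))),
    finite_index S /\
    group_isomorphic (subgroup (centralizer M)) (subgroup S).
Proof.
case: n n_ge2 M M_irr lambda_root => [//|n] _ M M_irr lambda_root.
pose theta := Subvs (memv_adjoin 1 lambda).
have theta_root : root (map_poly intr (char_poly (GLZ_val M))) theta.
  rewrite -(fmorph_root vsval) -map_poly_comp.
  by rewrite (eq_map_poly (g := intr)) // => z /=; rewrite rmorph_int.
exact: centralizer_finite_index M_irr (@subvs_adjoin_gen _ lambda) theta_root.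
Qed.
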